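(* (a) For every fixed $\epsilon$ with $0<\epsilon\le 2^{-8}$, both $Q(n,\epsilon,3)$ and $Q(n,\epsilon,4)$ are $\Theta(\log n)$ as $n\to\infty$ (with implied constants depending on $\epsilon$). (b) $Q(n,\epsilon,5)=\Theta(\epsilon^{-2})$ and $Q(n,\epsilon,6)=\Theta(\epsilon^{-1})$.
   Context: Graphs are finite and simple. The distance between two vertices is the length of a shortest path between them; the diameter of a connected graph is the maximum distance between two of its vertices, and a disconnected graph has diameter $\infty$. For an edge subset $E'\subseteq E$ of a graph $G$, the diameter of $E'$ is the diameter of the graph with edge set $E'$ whose vertex set is the set of vertices lying in at least one edge of $E'$. $Q(n,\epsilon,d)$ denotes the minimum $\ell$ such that the edges of any graph $G=(V,E)$ on $n$ vertices with minimum degree at least $\epsilon n$ can be covered by $\ell$ sets $E=E_1\cup\cdots\cup E_\ell$ (not necessarily disjoint) each of diameter at most $d$. In (b), $\Theta$ hides absolute positive constants. *)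

(* Defs.v *)
From HB Require Import structures.
From mathcomp Require Import all_boot all_order all_algebra.
From mathcomp Require Import reals.
Set Implicit Arguments.
Unset Strict Implicit.
Unset Printing Implicit Defensive.
Import Order.TTheory GRing.Theory Num.Theory.

(* A finite simple graph on the vertex set V is given by its edge set
   E : {set {set V}}, all of whose members have exactly two elements. *)

Section Graphs.
Variable V : finType.
Implicit Types (E F : {set {set V}}) (x y : V).

Definition simple_graph E : bool := [forall e in E, #|e| == 2].

Definition degree E x : nat := #|[set e in E | x \in e]|.

Definition adj E : rel V := fun x y => (x != y) && ([set x; y] \in E).

Definition has_path E x y (k : nat) : bool :=
  [exists p : k.-tuple V, [&& path (adj E) x p, uniq (x :: p) & last x p == y]].

(* A path has fewer than #|V| edges, so bounding k loses nothing. *)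
Definition joined E x y : bool := [exists k : 'I_#|V|, has_path E x y k].

Lemma has_path_joined E x y k : has_path E x y k -> joined E x y.
Proof.
move=> hk; have kV : k < #|V|.
  have /existsP[p /and3P[_ up _]] := hk.
  by have := max_card (mem (x :: p)); rewrite (card_uniqP up) /= size_tuple.
by apply/existsP; exists (Ordinal kV).
Qed.

Lemma joined_ex E x y : joined E x y -> exists k, has_path E x y k.
Proof. by case/existsP=> k hk; exists k. Qed.

(* Distances and diameters are extended naturals; None stands for infinity. *)
Definition dist E x y : option nat :=
  match @idP (joined E x y) with
  | ReflectT h => Some (ex_minn (joined_ex h))
  | ReflectF _ => None
  end.

(* cover F is the set of vertices lying in at least one edge of F. *)
Definition diameter F : option nat :=
  if [forall x in cover F, forall y in cover F, dist F x y != None]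
  then Some (\max_(x in cover F) \max_(y in cover F) odflt 0 (dist F x y))
  else None.

Definition diam_le F (d : nat) : bool :=
  if diameter F is Some k then k <= d else false.

Definition coverable E (l d : nat) : bool :=
  [exists f : {ffun 'I_l -> {set {set V}}},
    (E == \bigcup_(i < l) f i) && [forall i, diam_le (f i) d]].

Lemma distP E x y d :
  reflect (exists2 k, k <= d & has_path E x y k)
          (if dist E x y is Some k then k <= d else false).
Proof.
apply: (iffP idP); rewrite /dist; case: {-}_ / idP => [h|nh] //.
- by case: ex_minnP => m hm _ md; exists m.
- by case=> k kd hk; case: ex_minnP => m _ /(_ k hk) mk; apply: leq_trans kd.
- by case=> k _ /has_path_joined.
Qed.

Lemma diam_leP F d :
  reflect {in cover F &, forall x y, exists2 k, k <= d & has_path F x y k}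
          (diam_le F d).
Proof.
apply: (iffP idP) => [|H]; rewrite /diam_le /diameter.
  case: ifP => // /forall_inP fin /bigmax_leqP le_d x y xF yF.
  apply/distP; have := forall_inP (fin x xF) y yF.
  have := bigmax_leqP _ _ _ (le_d x xF) y yF.
  by case: dist.
have Hd x y : x \in cover F -> y \in cover F ->
    if dist F x y is Some k then k <= d else false.
  by move=> xF yF; apply/distP/H.
rewrite ifT.
  apply/bigmax_leqP => x xF; apply/bigmax_leqP => y yF.
  by have := Hd x y xF yF; case: dist.
apply/forall_inP => x xF; apply/forall_inP => y yF.
by have := Hd x y xF yF; case: dist.
Qed.

Lemma diam_le0 d : diam_le set0 d.
Proof. by apply/diam_leP => x y; rewrite /cover big_set0 inE. Qed.

Lemma diam_le1 (e : {set V}) d : 0 < d -> #|e| == 2 -> diam_le [set e] d.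
Proof.
move=> d0 e2; apply/diam_leP => x y.
rewrite /cover big_set1 => xe ye; have [<-|xy] := eqVneq x y.
  by exists 0 => //; apply/existsP; exists [tuple]; rewrite /= eqxx.
exists 1 => //; apply/existsP; exists [tuple y].
rewrite /= /adj xy !inE xy eqxx !andbT /= eqEcard cards2 xy (eqP e2) andbT.
by apply/subsetP => z /set2P[]->.
Qed.

Lemma coverable_all E d : 0 < d -> simple_graph E -> coverable E #|{set V}| d.
Proof.
move=> d0 /forall_inP sE; apply/existsP.
exists [ffun i => E :&: [set enum_val i]]; apply/andP; split.
  apply/eqP/setP => e; apply/idP/bigcupP => [eE|[i _]]; last first.
    by rewrite ffunE inE => /andP[].
  by exists (enum_rank e); rewrite // ffunE !inE enum_rankK eqxx eE.
apply/forallP => i; rewrite ffunE; have [iE|iE] := boolP (enum_val i \in E).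
  by rewrite (setIidPr _) ?sub1set//; apply: diam_le1 => //; apply: sE.
rewrite (_ : _ :&: _ = set0) ?diam_le0 //.
by apply/setP => e; rewrite !inE; case: eqP => [->|]; rewrite ?(negPf iE) ?andbF.
Qed.

End Graphs.

Definition min_degree_ge (R : realType) (n : nat) (E : {set {set 'I_n}})
    (a : R) : bool :=
  [forall x, (a <= (degree E x)%:R)%R].

Definition covers_all (R : realType) (n : nat) (eps : R) (d l : nat) : bool :=
  [forall E : {set {set 'I_n}},
    simple_graph E && min_degree_ge E (eps * n%:R)%R ==> coverable E l d].

Lemma covers_all_ex (R : realType) (n : nat) (eps : R) (d : nat) :
  0 < d -> exists l, covers_all n eps d l.
Proof.
move=> d0; exists #|{set 'I_n}|; apply/forallP => E; apply/implyP => /andP[sE _].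
exact: coverable_all.
Qed.

(* The proof of 0 < d only guarantees that the minimum exists: a nonempty edge
   set never has diameter 0. *)
Definition Q (R : realType) (n : nat) (eps : R) (d : nat) (d_gt0 : 0 < d) : nat :=
  ex_minn (covers_all_ex n eps d_gt0).

(* Main.v *)
(* Upper bounds: the edges lying on walks of length exactly d from x to y form a
   set of diameter at most d. An edge uv lies on a walk of length 3 from w to w'
   whenever w ~ u and v ~ w', so at least (eps n)^2 pairs (w, w') serve it and a
   greedy choice of O(log n) pairs suffices. If X is a maximal set of vertices
   with pairwise disjoint neighbourhoods, then |X| <= 1/eps and every vertex
   shares a neighbour with a member of X; pairs from X serve for d = 5, and
   closed walks at the points of X for d = 6.

   Lower bounds: disjoint cliques give 1/eps. For the rest, give each ordered
   pair (a, b) of distinct binary words a set S_ab of constant density with S_ab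
   and S_bc disjoint; the shift graph (a, b) - (b, c) has logarithmic chromatic
   number although fractionally a constant number of colours is enough. Take 2k
   dense bipartite blobs (s, i), with s a side and i < k, and for all i, j and
   (a, b) join a vertex of blob (0, i) with neighbourhood S_ab there to a similar
   vertex of blob (1, j). If consecutive pairs (a, b), (b, c) get the same colour
   on the matching between two blobs, the two edges contain vertices at distance
   5, which rules out d = 4. If they get the same colours simultaneously for all
   (i, j), then these k^2 colours are distinct when d = 5, since otherwise there
   would be vertices of two blobs on the same side at distance at most 5. *)
Require Import Defs.
From HB Require Import structures.
From mathcomp Require Import all_boot all_order all_algebra.
From mathcomp Require Import reals.
From mathcomp Require Import zify ring lra.
Set Implicit Arguments.
Unset Strict Implicit.
Unset Printing Implicit Defensive.
Import Order.TTheory GRing.Theory Num.Theory.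

(** * Covers by small-diameter edge sets *)

Section Walks.
Variable V : finType.
Implicit Types (E F : {set {set V}}) (x y z : V).

(** Vertices may repeat, unlike in [has_path], so walks can be reversed and concatenated;
    [walk_has_path] shortens the result. *)
Definition walk F (k : nat) x y : Prop :=
  exists p, [/\ path (adj F) x p, last x p = y & size p = k].

Lemma adj_sym F : symmetric (adj F).
Proof. by move=> x y; rewrite /adj eq_sym setUC. Qed.

Lemma walk_sym F k x y : walk F k x y -> walk F k y x.
Proof.
case=> p [pp <- <-]; exists (rev (belast x p)); split.
- by rewrite rev_path; under eq_path do rewrite adj_sym.
- by case: p {pp} => //= a p; rewrite rev_cons last_rcons.
- by rewrite size_rev size_belast.
Qed.

Lemma walk_cat F k m x y z : walk F k x y -> walk F m y z -> walk F (k + m) x z.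
Proof.
case=> p [pp <- <-] [r [pr <- <-]]; exists (p ++ r).
by rewrite cat_path pp pr last_cat size_cat.
Qed.

Lemma walk_has_path F k x y :
  walk F k x y -> exists2 m, m <= k & has_path F x y m.
Proof.
case=> p [pp <- <-]; case/shortenP: pp => p' pp' up' sub.
exists (size p'); first by apply: uniq_leq_size => //; case/andP: up'.
by apply/existsP; exists (in_tuple p'); rewrite pp' up' eqxx.
Qed.

Lemma has_path_walk F k x y : has_path F x y k -> walk F k x y.
Proof. by case/existsP=> p /and3P[pp _ /eqP <-]; exists p; rewrite size_tuple. Qed.

Definition walk_edges E (d : nat) x y : {set {set V}} :=
  [set e | [exists p : d.-tuple V, exists i : 'I_d,
    [&& path (adj E) x p, last x p == y & e == [set nth x (x :: p) i; nth x p i]]]].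

Lemma walk_edges_path E x p :
  path (adj E) x p -> path (adj (walk_edges E (size p) x (last x p))) x p.
Proof.
move=> pp; apply/(pathP x) => i ip; have /andP[ne _] := pathP x pp i ip.
rewrite /adj ne inE; apply/existsP; exists (in_tuple p).
by apply/existsP; exists (Ordinal ip); rewrite pp !eqxx.
Qed.

Lemma walk_edges_sub E d x y : walk_edges E d x y \subset E.
Proof.
apply/subsetP => e; rewrite inE => /existsP[p /existsP[i /and3P[pp _ /eqP->]]].
by have /andP[] := pathP x pp i (leq_trans (ltn_ord i) (eq_leq (esym (size_tuple p)))).
Qed.

(** The edges of a witnessing walk all belong to the set, so cutting the walk at z leaves both
    halves inside it. *)
Lemma walk_edges_cover E d x y z : z \in cover (walk_edges E d x y) ->
  exists i, [/\ i <= d, walk (walk_edges E d x y) i x z &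
                walk (walk_edges E d x y) (d - i) z y].
Proof.
case/bigcupP=> e; rewrite inE => /existsP[p /existsP[i /and3P[pp /eqP lp /eqP->]]] ze.
have [j jd zj] : exists2 j, j <= d & z = nth x (x :: p) j.
  by case/set2P: ze => ->; [exists i; rewrite // ltnW | exists i.+1].
have := walk_edges_path pp; rewrite lp size_tuple -{1}(cat_take_drop j p) cat_path.
have sj : size (take j p) = j by rewrite size_takel ?size_tuple.
have lz : last x (take j p) = z.
  rewrite zj (last_nth x) sj; case: j {jd zj} sj => //= j sj.
  by rewrite nth_take.
rewrite lz => /andP[p1 p2]; exists j; split=> //; first by exists (take j p).
exists (drop j p); rewrite size_drop size_tuple; split=> //.
by rewrite -lp -[in RHS](cat_take_drop j p) last_cat lz.
Qed.

(* Two vertices at positions i and j of such walks are joined through x by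
   i + j edges and through y by 2 d - (i + j) edges. *)
Lemma walk_edges_diam E d x y : diam_le (walk_edges E d x y) d.
Proof.
apply/diam_leP => u v /walk_edges_cover[i [id xu uy]] /walk_edges_cover[j [jd xv vy]].
have [ij|ij] := leqP (i + j) d.
  have [m mle hm] := walk_has_path (walk_cat (walk_sym xu) xv).
  by exists m => //; apply: leq_trans ij.
have [m mle hm] := walk_has_path (walk_cat uy (walk_sym vy)).
by exists m => //; apply: leq_trans mle _; lia.
Qed.

Lemma mem_walk_edges3 E u v w w' : adj E w u -> adj E u v -> adj E v w' ->
  [set u; v] \in walk_edges E 3 w w'.
Proof.
move=> wu uv vw; rewrite inE; apply/existsP; exists [tuple u; v; w'].
by apply/existsP; exists (@Ordinal 3 1 isT); rewrite /= wu uv vw !eqxx.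
Qed.

Lemma mem_walk_edges5 E u v w w' x y :
  adj E x w -> adj E w u -> adj E u v -> adj E v w' -> adj E w' y ->
  [set u; v] \in walk_edges E 5 x y.
Proof.
move=> xw wu uv vw wy; rewrite inE; apply/existsP; exists [tuple w; u; v; w'; y].
by apply/existsP; exists (@Ordinal 5 2 isT); rewrite /= xw wu uv vw wy !eqxx.
Qed.

(** The walk x, w, u, v, u, w, x goes out along uv and retraces its steps. *)
Lemma mem_walk_edges6 E u v w x : adj E x w -> adj E w u -> adj E u v ->
  [set u; v] \in walk_edges E 6 x x.
Proof.
move=> xw wu uv; rewrite inE; apply/existsP; exists [tuple w; u; v; u; w; x].
apply/existsP; exists (@Ordinal 6 2 isT); rewrite /= xw wu uv.
by rewrite (adj_sym E v) (adj_sym E u w) (adj_sym E w x) uv wu xw !eqxx.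
Qed.

Lemma simple_edge E e : simple_graph E -> e \in E ->
  exists u v, e = [set u; v] /\ adj E u v.
Proof.
move=> /forall_inP sE eE; have /cards2P[u [v [uv ev]]] := sE e eE.
by exists u, v; split=> //; rewrite /adj uv -ev.
Qed.

Lemma degreeE E x : simple_graph E -> degree E x = #|[set y | adj E x y]|.
Proof.
move=> sE; rewrite -(@card_in_imset _ _ (fun y => [set x; y])); last first.
  move=> y z; rewrite !inE => /andP[xy _] /andP[xz _] /setP/(_ y).
  by rewrite !inE eqxx orbT eq_sym (negPf xy) => /esym/eqP.
apply: eq_card => e; rewrite !inE; apply/andP/imsetP => [[eE xe]|[y]].
  have [u [v [ev uv]]] := simple_edge sE eE.
  move: xe; rewrite ev => /set2P[]->; first by exists v; rewrite ?inE.
  by exists u; rewrite ?inE 1?adj_sym // setUC.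
by rewrite inE => /andP[_ xyE] ->; rewrite xyE set21.
Qed.

(** Indices of ['I_l] beyond the list receive the empty set, which satisfies every diameter
    bound. *)
Lemma coverable_seq E l d (s : seq {set {set V}}) : size s <= l ->
  {in s, forall F, F \subset E /\ diam_le F d} ->
  (forall u v, adj E u v -> exists2 F, F \in s & [set u; v] \in F) ->
  simple_graph E -> coverable E l d.
Proof.
move=> sl sF cov sE; apply/existsP; exists [ffun i : 'I_l => nth set0 s i].
apply/andP; split; last first.
  apply/forallP => i; rewrite ffunE; have [/(mem_nth set0)/sF[]//|?] := ltnP i (size s).
  by rewrite nth_default ?diam_le0.
apply/eqP/setP => e; apply/idP/bigcupP => [eE|[i _]]; last first.
  rewrite ffunE; have [/(mem_nth set0)/sF[/subsetP + _]|?] := ltnP i (size s); first exact.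
  by rewrite nth_default ?inE.
have [u [v [-> /cov[F Fs uvF]]]] := simple_edge sE eE.
have iF : index F s < l by apply: leq_trans sl; rewrite index_mem.
by exists (Ordinal iF); rewrite // ffunE /= nth_index.
Qed.

Lemma lipschitz_walk F (f : V -> nat) k x y :
  (forall u v, adj F u v -> f v <= (f u).+1) -> walk F k x y -> f y <= f x + k.
Proof.
move=> lip [p [pp <- <-]] {k y}; elim: p x pp => [|y p IH] x /=; first by rewrite addn0.
by case/andP=> /lip xy /IH le; apply: leq_trans le _; rewrite addnS -addSn leq_add2r.
Qed.

(** All lower bounds use covers in this form. Colour each edge by one set containing it; edges of
    the same colour are joined by paths of length at most d in that set, hence in E, and f rises by
    at most 1 per step. *)
Lemma coverable_colouring E l d : coverable E l d ->
  exists2 g : {set V} -> nat, {in E, forall e, g e < l} &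
    forall e e' (f : V -> nat), e \in E -> e' \in E -> g e = g e' ->
      (forall u v, adj E u v -> f v <= (f u).+1) ->
      forall x y, x \in e -> y \in e' -> f y <= f x + d.
Proof.
case/existsP=> F /andP[/eqP EF /forallP dF].
pose g e := if [pick i | e \in F i] is Some i then val i else l.
have gP e : e \in E -> exists2 i : 'I_l, g e = i & e \in F i.
  rewrite EF => /bigcupP[i _ ei]; rewrite /g.
  by case: pickP => [j ej|/(_ i)]; [exists j | rewrite ei].
exists g => [e /gP[i -> _] //|e e' f /gP[i gi ei] /gP[j gj ej] gg lip x y xe ye].
have ij : i = j by apply: val_inj; rewrite /= -gi -gj.
have mc e0 z : e0 \in F i -> z \in e0 -> z \in cover (F i).
  by move=> e0i ze; apply/bigcupP; exists e0.
have [||m md /has_path_walk wm] := diam_leP _ _ (dF i) x y.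
- exact: mc ei xe.
- by apply: mc ye; rewrite ij.
apply: leq_trans (lipschitz_walk _ wm) _; last by rewrite leq_add2l.
move=> u v /andP[uv uvF]; apply: lip; rewrite /adj uv EF.
by apply/bigcupP; exists i.
Qed.

End Walks.

(** Averaging: each uncovered element is covered by at least a fraction a of I, so some i covers at
    least a fraction a of the uncovered elements, and the best i multiplies their number by at most
    1 - a. *)
Lemma greedy_cover (R : realFieldType) (I X : finType) (cov : I -> X -> bool)
    (U : {set X}) (a : R) :
  0 < #|I| -> (a <= 1)%R ->
  {in U, forall x, (a * #|I|%:R <= #|[set i | cov i x]|%:R)%R} ->
  forall t, exists2 s : seq I, size s = t &
    (#|[set x in U | ~~ has (cov^~ x) s]|%:R <= (1 - a) ^+ t * #|U|%:R)%R.
Proof.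
move=> I0 a1 hU; elim=> [|t [s <- IH]].
  exists [::] => //; rewrite expr0 mul1r ler_nat; apply/subset_leq_card/subsetP => x.
  by rewrite inE => /andP[].
set W := [set x in U | _] in IH *.
have /card_gt0P[i0 _] := I0; pose c i := #|[set x in W | cov i x]|.
pose i := [arg max_(i > i0) c i].
have ci j : c j <= c i by rewrite /i; case: arg_maxnP => // k _; apply.
exists (i :: s) => //.
set W' := [set x in U | _].
have WW : #|W'| + c i = #|W|.
  rewrite -(cardsID [set x | cov i x] W) addnC; congr (_ + _); apply: eq_card => x.
    by rewrite !inE.
  by rewrite !inE /= negb_or; case: (x \in U); case: (cov i x); rewrite ?andbF.
have cW : (a * #|W|%:R <= (c i)%:R)%R.
  rewrite -(ler_pM2l (x := #|I|%:R)) ?ltr0n //.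
  have -> : (#|I|%:R * (a * #|W|%:R) = \sum_(x in W) a * #|I|%:R :> R)%R.
    by rewrite sumr_const -[RHS]mulr_natr; lra.
  apply: (@le_trans _ _ (\sum_(x in W) #|[set j | cov j x]|%:R)%R).
    by apply: ler_sum => x; rewrite inE => /andP[xU _]; apply: hU.
  rewrite -natr_sum -natrM ler_nat.
  (* Double counting of the pairs (x, j) with x in W covered by j. *)
  have -> : \sum_(x in W) #|[set j | cov j x]| = \sum_j c j.
    rewrite /c; under eq_bigr => x _ do rewrite -sum1_card.
    under [RHS]eq_bigr => j _ do rewrite -sum1_card.
    rewrite (exchange_big_dep predT) //=; apply: eq_bigr => j _.
    by apply: eq_bigl => x; rewrite !inE.
  by rewrite -sum_nat_const; apply: leq_sum.
have -> : (#|W'|%:R = #|W|%:R - (c i)%:R :> R)%R by rewrite -WW natrD addrK.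
apply: (@le_trans _ _ ((1 - a) * #|W|%:R)%R); first lra.
by rewrite exprS -mulrA; apply: ler_wpM2l; rewrite ?subr_ge0.
Qed.

(** * Upper bounds for d = 3, 5, 6 *)

Section UpperBounds.
Variables (R : realType) (n : nat) (eps : R).
Hypothesis eps_gt0 : (0 < eps)%R.
Variable E : {set {set 'I_n}}.
Hypotheses (sE : simple_graph E) (dE : min_degree_ge E (eps * n%:R)%R).

Lemma nbhd_card x : (eps * n%:R <= #|[set y | adj E x y]|%:R)%R.
Proof. by rewrite -degreeE //; apply: (forallP dE). Qed.

Lemma nbhd_ex x : exists w, adj E x w.
Proof.
have n0 : (0 < n)%N by case: n x => // -[].
have : (0 < #|[set y | adj E x y]|%:R :> R)%R.
  by apply: lt_le_trans (nbhd_card x); rewrite mulr_gt0 // ltr0n.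
by rewrite ltr0n => /card_gt0P[w]; rewrite inE; exists w.
Qed.

Lemma square_dominating_set : exists2 X : {set 'I_n},
  (#|X|%:R <= eps^-1)%R &
  forall u, exists x w, [/\ x \in X, adj E x w & adj E w u].
Proof.
pose P (X : {set 'I_n}) :=
  [forall x in X, forall y in X, forall w, adj E x w && adj E y w ==> (x == y)].
have P0 : P set0 by apply/forall_inP => x; rewrite inE.
have [X /maxsetP[PX maxX] _] := maxset_exists P0.
exists X.
  have [n0|n0] := posnP n.
    have /eqP-> : #|X| == 0 by rewrite -leqn0 (leq_trans (max_card _)) // card_ord n0.
    by rewrite invr_ge0 ltW.
  (* The neighbourhoods of the members of X are disjoint, have at least eps n elements each, and fit
     into n vertices. *)
  rewrite -[(eps^-1)%R]mul1r ler_pdivlMr // -(ler_pM2r (x := n%:R)) ?ltr0n //.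
  rewrite mul1r -mulrA.
  have -> : (#|X|%:R * (eps * n%:R) = \sum_(x in X) eps * n%:R :> R)%R.
    by rewrite sumr_const mulr_natl.
  apply: (@le_trans _ _ (\sum_(x in X) #|[set y | adj E x y]|%:R)%R).
    by apply: ler_sum => x _; apply: nbhd_card.
  rewrite -natr_sum ler_nat.
  under eq_bigr => x _ do rewrite -sum1_card.
  rewrite (exchange_big_dep predT) //= -[leqRHS]card_ord -sum1_card.
  apply: leq_sum => w _; rewrite sum1_card.
  apply/card_le1P => x /andP[xX]; rewrite inE => xw y.
  apply/idP/eqP => [/andP[yX]|->]; last by rewrite -!topredE /= xX inE.
  rewrite inE => yw; have := forall_inP (forall_inP PX y yX) x xX => /forallP/(_ w).
  by rewrite yw xw => /eqP.
(* A member of X is reached from itself through any neighbour. For other u, maximality makes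
   [u |: X] violate [P], and the violating pair must contain u. *)
move=> u; have [uX|uX] := boolP (u \in X).
  by have [w uw] := nbhd_ex u; exists u, w; rewrite uX uw adj_sym uw.
have [PuX|] := boolP (P (u |: X)).
  by move: uX; rewrite -(maxX _ PuX (subsetUr _ _)) setU11.
have key x : x \in X -> (exists w, adj E x w && adj E u w) ->
    exists x w, [/\ x \in X, adj E x w & adj E w u].
  by move=> xX [w /andP[xw uw]]; exists x, w; rewrite xX xw adj_sym.
case/forall_inPn=> x xU /forall_inPn[y yU /forallPn[w]].
rewrite negb_imply => /andP[/andP[xw yw] xy].
case/setU1P: xU => [xu|xX]; case/setU1P: yU => [yu|yX].
- by rewrite xu yu eqxx in xy.
- by apply: (key y) => //; exists w; rewrite -xu xw yw.
- by apply: (key x) => //; exists w; rewrite -yu xw yw.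
- have /implyP := forallP (forall_inP (forall_inP PX x xX) y yX) w.
  by rewrite xw yw (negPf xy) => /(_ isT).
Qed.

Lemma coverable6 : coverable E (Num.truncn eps^-1%R) 6.
Proof.
have [X cX hX] := square_dominating_set.
apply: (@coverable_seq _ _ _ _ [seq walk_edges E 6 x x | x <- enum X]) => //.
- by rewrite size_map -cardE -(@natrK R #|X|); apply: le_truncn.
- by move=> F /mapP[x _ ->]; split; [apply: walk_edges_sub | apply: walk_edges_diam].
move=> u v uv; have [x [w [xX xw wu]]] := hX u.
exists (walk_edges E 6 x x); last exact: mem_walk_edges6 xw wu uv.
by apply/mapP; exists x; rewrite ?mem_enum.
Qed.

Lemma coverable5 : coverable E (Num.truncn (eps ^- 2)%R) 5.
Proof.
have [X cX hX] := square_dominating_set.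
apply: (@coverable_seq _ _ _ _ [seq walk_edges E 5 z.1 z.2 | z <- enum (setX X X)]) => //.
- rewrite size_map -cardE cardsX -(@natrK R (_ * _)); apply: le_truncn.
  by rewrite natrM -exprVn expr2 ler_pM.
- by move=> F /mapP[x _ ->]; split; [apply: walk_edges_sub | apply: walk_edges_diam].
move=> u v uv; have [x [w [xX xw wu]]] := hX u; have [y [w' [yX yw wv]]] := hX v.
exists (walk_edges E 5 x y).
  by apply/mapP; exists (x, y); rewrite ?mem_enum ?inE ?xX.
by apply: (mem_walk_edges5 xw wu uv (w' := w')); rewrite adj_sym.
Qed.

Lemma coverable3 t : (eps <= 1)%R -> ((1 - eps ^+ 2) ^+ t * n%:R ^+ 2 < 1)%R ->
  coverable E t 3.
Proof.
move=> eps1 ht.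
have [n0|n0] := posnP n.
  apply: (@coverable_seq _ _ _ _ [::]) => // u; exfalso; by case: n u n0 => // -[].
pose cov (w z : 'I_n * 'I_n) := [set z.1; z.2] \in walk_edges E 3 w.1 w.2.
pose U := [set z : 'I_n * 'I_n | adj E z.1 z.2].
have [|||s st sU] := @greedy_cover R _ _ cov U (eps ^+ 2)%R _ _ _ t.
- by rewrite card_prod card_ord muln_gt0 n0.
- by rewrite expr_le1 // ltW.
- move=> [u v]; rewrite inE /= => uv.
  apply: (@le_trans _ _ #|setX [set w | adj E u w] [set w | adj E v w]|%:R%R).
    rewrite cardsX card_prod card_ord !natrM expr2 mulrACA.
    by apply: ler_pM; rewrite ?nbhd_card // mulr_ge0 // ltW.
  rewrite ler_nat; apply/subset_leq_card/subsetP => -[w w'].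
  rewrite !inE /= => /andP[uw vw].
  by apply: (mem_walk_edges3 _ uv vw); rewrite adj_sym.
apply: (@coverable_seq _ _ _ _ [seq walk_edges E 3 z.1 z.2 | z <- s]) => //.
- by rewrite size_map st.
- by move=> F /mapP[x _ ->]; split; [apply: walk_edges_sub | apply: walk_edges_diam].
move=> u v uv.
(* As U has at most n^2 elements, fewer than one, hence none, is left uncovered. *)
have : #|[set x in U | ~~ has (cov^~ x) s]| == 0%N.
  rewrite -leqn0 -ltnS -(ltr_nat R); apply: le_lt_trans ht; apply: le_trans sU _.
  apply: ler_wpM2l; first by rewrite exprn_ge0 // subr_ge0 expr_le1 // ltW.
  by rewrite -natrX ler_nat (leq_trans (max_card _)) // card_prod card_ord.
rewrite cards_eq0 => /eqP/setP/(_ (u, v)); rewrite !inE /= uv /= => /negbFE/hasP[w ws cw].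
by exists (walk_edges E 3 w.1 w.2) => //; apply/mapP; exists w.
Qed.

End UpperBounds.

(** * Blow-ups of a fixed graph and a shift-graph construction *)

Section RelGraph.
Variables (V : finType) (r : rel V).
Hypotheses (rsym : symmetric r) (rirr : irreflexive r).

Definition rel_graph : {set {set V}} :=
  [set [set z.1; z.2] | z in [set z : V * V | r z.1 z.2]].

Lemma mem_rel_graph x y : r x y -> [set x; y] \in rel_graph.
Proof. by move=> rxy; apply/imsetP; exists (x, y); rewrite ?inE. Qed.

Lemma adj_rel_graph x y : adj rel_graph x y = r x y.
Proof.
apply/andP/idP => [[xy /imsetP[[u v]]]|rxy]; last first.
  by split; [apply: contraTneq rxy => ->; rewrite rirr | apply: mem_rel_graph].
rewrite inE /= => ruv exy.
have xe : x \in [set u; v] by rewrite -exy set21.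
have ye : y \in [set u; v] by rewrite -exy set22.
case/set2P: xe xy => ->; case/set2P: ye => -> //; rewrite ?eqxx //.
by rewrite rsym.
Qed.

Lemma rel_graph_simple : simple_graph rel_graph.
Proof.
apply/forall_inP => e /imsetP[[u v]]; rewrite inE /= => ruv ->.
by rewrite cards2 (_ : u != v) //; apply: contraTneq ruv => ->; rewrite rirr.
Qed.

Lemma degree_rel_graph x : degree rel_graph x = #|[set y | r x y]|.
Proof.
rewrite degreeE ?rel_graph_simple //; apply: eq_card => y.
by rewrite !inE adj_rel_graph.
Qed.

End RelGraph.

(** * Disjoint cliques *)

Lemma card_residue n m s : s < m -> n %/ m <= #|[set w : 'I_n | w %% m == s]|.
Proof.
move=> sm; have hw (t : 'I_(n %/ m)) : t * m + s < n.
  apply: (@leq_trans (t.+1 * m)); first by rewrite mulSn addnC ltn_add2r.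
  by apply: leq_trans (leq_trunc_div n m); rewrite leq_mul2r ltn_ord orbT.
rewrite -[leqLHS]card_ord -(@card_imset _ _ (fun t => Ordinal (hw t))); last first.
  move=> t t' /(congr1 val) /= /addIn /eqP.
  by rewrite eqn_pmul2r ?(leq_ltn_trans _ sm) // => /eqP/val_inj.
apply/subset_leq_card/subsetP => w /imsetP[t _ ->].
by rewrite inE /= modnMDl modn_small.
Qed.

(** The cliques are the residue classes modulo m. The edges {i, m + i}, one in each class, must get
    distinct colours. *)
Lemma disjoint_cliques (R : realType) n (eps : R) d l m : 0 < m ->
  m.*2 <= n -> (eps * n%:R <= (n %/ m).-1%:R)%R -> covers_all n eps d l -> m <= l.
Proof.
move=> m0 mn deg cov; pose r : rel 'I_n := fun v w => (v != w) && (v %% m == w %% m).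
have rsym : symmetric r by move=> v w; rewrite /r eq_sym [X in _ && X]eq_sym.
have rirr : irreflexive r by move=> v; rewrite /r eqxx.
have /implyP/(_ _)/coverable_colouring[|g gl gP] := forallP cov (rel_graph r).
  rewrite rel_graph_simple //=; apply/forallP => v; rewrite degree_rel_graph //.
  apply: le_trans deg _; rewrite ler_nat.
  have le := card_residue n (ltn_pmod v m0).
  rewrite -subn1 leq_subLR (leq_trans le) //.
  rewrite (cardsD1 v [set w : 'I_n | w %% m == v %% m]) inE eqxx leq_add2l.
  apply/subset_leq_card/subsetP => w.
  by rewrite !inE /r eq_sym [X in _ && X -> _]eq_sym.
have hu (i : 'I_m) : i < n by apply: leq_trans (ltn_ord i) _; lia.
have hv (i : 'I_m) : m + i < n by have := ltn_ord i; lia.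
pose e i := [set Ordinal (hu i); Ordinal (hv i)].
have eE i : e i \in rel_graph r.
  apply: mem_rel_graph; rewrite /r /= modnDl eqxx andbT.
  by apply/eqP => /(congr1 val) /=; lia.
have inj : injective (fun i => Ordinal (gl _ (eE i))).
  move=> i j /(congr1 val) /= gij; apply/eqP; apply: contraT => ij.
  (* No edge leaves a residue class, so f is constant along edges although it jumps by d + 1 between
     classes. *)
  pose f (v : 'I_n) := if v %% m == i then 0 else d.+1.
  have lip u v : adj (rel_graph r) u v -> f v <= (f u).+1.
    by rewrite adj_rel_graph // /f => /andP[_ /eqP->]; exact: leqnSn.
  have := gP _ _ f (eE i) (eE j) gij lip _ _ (set21 _ _) (set21 _ _).
  rewrite /f /= !modn_small // eqxx (_ : (j == i :> nat) = false) ?ltnn //.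
  by apply/negbTE; rewrite eq_sym.
by have := leq_card _ inj; rewrite !card_ord.
Qed.

(** * Blow-ups of a fixed graph *)

Section BlowUp.
Variables (T : finType) (H : rel T) (n : nat).
Hypotheses (Hsym : symmetric H) (Hirr : irreflexive H).
Hypotheses (T_gt0 : 0 < #|T|) (T_le : #|T| <= n).

Definition blow_label (v : 'I_n) : T := enum_val (Ordinal (ltn_pmod v T_gt0)).

Definition blow_rep (x : T) : 'I_n :=
  Ordinal (leq_trans (ltn_ord (enum_rank x)) T_le).

Lemma blow_repK : cancel blow_rep blow_label.
Proof.
move=> x; rewrite /blow_label -[RHS]enum_rankK; congr enum_val.
by apply: val_inj; rewrite /= modn_small.
Qed.

Lemma card_blow_label (y : T) : n %/ #|T| <= #|[set w | blow_label w == y]|.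
Proof.
apply: leq_trans (card_residue n (ltn_ord (enum_rank y))) _.
apply/subset_leq_card/subsetP => w; rewrite !inE => /eqP wy; apply/eqP.
by rewrite -[RHS]enum_rankK; congr enum_val; apply: val_inj.
Qed.

Definition blow_up : {set {set 'I_n}} :=
  rel_graph (fun v w => H (blow_label v) (blow_label w)).

Lemma blow_up_min_degree (R : realType) (eps : R) deg :
  (0 <= eps)%R -> (2 * eps * #|T|%:R <= deg%:R)%R ->
  (forall x, deg <= #|[set y | H x y]|) -> min_degree_ge blow_up (eps * n%:R)%R.
Proof.
move=> eps0 le_deg hdeg; apply/forallP => v.
rewrite degree_rel_graph; last 2 first.
- by move=> x y; rewrite Hsym.
- by move=> x; rewrite Hirr.
apply: (@le_trans _ _ (deg * (n %/ #|T|))%:R%R).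
  apply: (@le_trans _ _ (2 * eps * #|T|%:R * (n %/ #|T|)%:R)%R); last first.
    by rewrite natrM ler_wpM2r.
  (* As [#|T| <= n], rounding the quotient down loses at most a factor 2, the one in the hypothesis
     on [deg]. *)
  have: (n%:R <= 2 * #|T|%:R * (n %/ #|T|)%:R :> R)%R.
    rewrite -!natrM ler_nat {1}(divn_eq n #|T|).
    have q1 : 0 < n %/ #|T| by rewrite divn_gt0.
    have := leq_pmull #|T| q1; have := ltn_pmod n T_gt0; nia.
  by move=> /(ler_wpM2l eps0) le; apply: le_trans le _; rewrite !mulrA [(eps * 2)%R]mulrC.
rewrite ler_nat; set x := blow_label v.
apply: (@leq_trans (\sum_(y in [set y | H x y]) #|[set w | blow_label w == y]|)).
  apply: (@leq_trans (\sum_(y in [set y | H x y]) n %/ #|T|)).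
    by rewrite sum_nat_const leq_mul2r hdeg orbT.
  by apply: leq_sum => y _; apply: card_blow_label.
under eq_bigr => y _ do rewrite -sum1_card.
rewrite -[leqRHS]sum1_card.
rewrite [leqRHS](partition_big blow_label (mem [set y | H x y])) /=; last first.
  by move=> w; rewrite !inE.
apply: leq_sum => y; rewrite inE => Hxy; apply: eq_leq.
by apply: eq_bigl => w; rewrite !inE; case: eqP => [->|]; rewrite ?andbF // Hxy.
Qed.

(** Composing f with [blow_label] gives a function on the blow-up that still rises by at most 1 per
    edge, so it suffices to colour the edges between representatives. *)
Lemma blow_up_colouring (R : realType) (eps : R) deg d l :
  (0 <= eps)%R -> (2 * eps * #|T|%:R <= deg%:R)%R ->
  (forall x, deg <= #|[set y | H x y]|) -> covers_all n eps d l ->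
  exists2 g : T -> T -> nat, forall x y, H x y -> g x y < l &
    forall x y x' y' (f : T -> nat), H x y -> H x' y' -> g x y = g x' y' ->
      (forall u v, H u v -> f v <= (f u).+1) ->
      [/\ f x' <= f x + d, f y' <= f x + d & f y' <= f y + d].
Proof.
move=> eps0 le_deg hdeg cov.
have bsym : symmetric (fun v w => H (blow_label v) (blow_label w)).
  by move=> x y; rewrite Hsym.
have birr : irreflexive (fun v w => H (blow_label v) (blow_label w)).
  by move=> x; rewrite Hirr.
have /implyP/(_ _)/coverable_colouring[|g gl gP] := forallP cov blow_up.
  by rewrite rel_graph_simple //=; apply: blow_up_min_degree le_deg hdeg.
have rE x y : H x y -> [set blow_rep x; blow_rep y] \in blow_up.
  by move=> Hxy; apply: mem_rel_graph; rewrite !blow_repK.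
exists (fun x y => g [set blow_rep x; blow_rep y]) => [x y /rE/gl//|].
move=> x y x' y' f /rE xy /rE xy' gg lip.
have lip' u v : adj blow_up u v -> f (blow_label v) <= (f (blow_label u)).+1.
  by rewrite adj_rel_graph //; apply: lip.
have {}gP := gP _ _ (f \o blow_label) xy xy' gg lip'.
pose r := blow_rep.
split;
  [move: (gP (r x) (r x')) | move: (gP (r x) (r y')) | move: (gP (r y) (r y'))];
  by rewrite /= !blow_repK; apply; rewrite ?set21 ?set22.
Qed.

End BlowUp.

(* If there is no such triple, the colours of the pairs (a, b) with b != a
   determine a. *)
Lemma shift_pair (A P : finType) (phi : A * A -> P) : 2 ^ #|P| < #|A| ->
  exists a b c, [/\ a != b, b != c & phi (a, b) = phi (b, c)].
Proof.
move=> big; pose out a := [set phi (a, b) | b in [set b | a != b]].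
have : ~~ injectiveb out.
  apply: contraL big => /injectiveP/leq_card.
  by rewrite -[#|{set P}|]cardsT -powersetT card_powerset cardsT -leqNgt.
case/injectivePn=> a [b ab eab].
have : phi (a, b) \in out b by rewrite -eab; apply/imsetP; exists b; rewrite ?inE.
by case/imsetP=> c; rewrite inE => bc e; exists a, b, c.
Qed.

(** * The shift-graph construction and its distances *)

Section ShiftBlobs.
Variables k q : nat.

Definition word : predArgType := {ffun 'I_q -> bool}.

Lemma card_word : #|word| = 2 ^ q.
Proof. by rewrite card_ffun card_bool card_ord. Qed.

Definition dot (a v : word) : bool := \big[addb/false]_i (a i && v i).

(** This is the set S_ab: affine functionals over the field of two elements, with linear part [w.1]
    and constant [w.2], that are 1 at a and 0 at b. It is everything when a = b, so that those
    terminals also have large degree. *)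
Definition separates (w : word * bool) (p : word * word) : bool :=
  (p.1 != p.2) ==> (dot p.1 w.1 (+) w.2) && ~~ (dot p.2 w.1 (+) w.2).

(** The functional would have to be both 0 and 1 at b. *)
Lemma separates_consecutive w a b c : a != b -> b != c ->
  separates w (a, b) -> separates w (b, c) -> False.
Proof. by rewrite /separates /= => -> -> /andP[_ /negPf->]. Qed.

Lemma dot_add a b v :
  dot a v (+) dot b v = \big[addb/false]_i ((a i (+) b i) && v i).
Proof. by rewrite /dot -big_split /=; apply: eq_bigr => i _; rewrite andb_addl. Qed.

(* Flipping a coordinate where the two words differ changes the sum of the two
   dot products, so at least half of the v give a sum of 1. *)
Lemma card_separates p : 2 ^ q <= 2 * #|[set w | separates w p]|.
Proof.
case: p => a b; have [->|ab] := eqVneq a b.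
  rewrite (_ : [set w | _] = setT) ?cardsT ?card_prod ?card_bool ?card_word; first by lia.
  by apply/setP => w; rewrite !inE /separates eqxx.
have [i abi] : exists i, a i != b i.
  apply/existsP; apply: contraR ab; rewrite negb_exists => /forallP h.
  by apply/eqP/ffunP => i; apply/eqP; have := h i; rewrite negbK.
pose flip (v : word) : word := [ffun j => (j == i) (+) v j].
have flipK : involutive flip by move=> v; apply/ffunP => j; rewrite !ffunE addKb.
pose odds := [set v | dot a v (+) dot b v].
have flip_odds v : (flip v \in odds) = (v \notin odds).
  rewrite !inE !dot_add (bigD1 i) //= [in RHS](bigD1 i) //=.
  rewrite ffunE eqxx addTb.
  rewrite (eq_bigr (fun j => (a j (+) b j) && v j)); last first.
    by move=> j /negPf ji; rewrite ffunE ji.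
  have -> : a i (+) b i by move: abi; case: (a i); case: (b i).
  by rewrite /= addNb.
have odds_sep : #|odds| <= #|[set w | separates w (a, b)]|.
  (* When the two dot products differ, this constant makes the functional 1 at a and 0 at b. *)
  rewrite -(@card_imset _ _ (fun v => (v, ~~ dot a v))); last by move=> u v [].
  apply/subset_leq_card/subsetP => w /imsetP[v]; rewrite !inE => hv ->.
  by rewrite /separates ab /=; move: hv; case: (dot a v); case: (dot b v).
have compl_odds : #|~: odds| <= #|odds|.
  rewrite -(card_imset _ (inv_inj flipK)); apply/subset_leq_card/subsetP => w.
  by case/imsetP=> v; rewrite in_setC -flip_odds => + ->.
by rewrite -card_word -(cardsC odds); lia.
Qed.

(* A blob is a pair (s, i), with side s. Its core is a complete bipartite graph
   between vertices flagged true, which carry a functional (v, s), and vertices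
   flagged false. The last component only makes cores outnumber terminals. The
   terminal (s, i, j, p) of blob (s, i) is matched to the terminal
   (~~ s, j, i, p) of blob (~~ s, j). *)
Definition terminal : predArgType := (bool * 'I_k * 'I_k * (word * word))%type.
Definition core : predArgType :=
  (bool * 'I_k * bool * (word * bool) * ('I_k * word))%type.
Definition blob : predArgType := (terminal + core)%type.

Definition blob_adj : rel blob := fun x y =>
  match x, y with
  | inl (s, i, j, p), inl (s', i', j', p') =>
      [&& s' == ~~ s, i' == j, j' == i & p' == p]
  | inl (s, i, j, p), inr (s', i', fl, w, _)
  | inr (s', i', fl, w, _), inl (s, i, j, p) =>
      [&& s' == s, i' == i, fl & separates w p]
  | inr (s, i, fl, w, _), inr (s', i', fl', w', _) =>
      [&& s' == s, i' == i & fl' == ~~ fl]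
  end.

Lemma blob_adj_sym : symmetric blob_adj.
Proof.
move=> [[[[s i] j] p]|[[[[s i] fl] w] d]]
       [[[[s' i'] j'] p']|[[[[s' i'] fl'] w'] d']] //=.
  rewrite ![s == _]eq_sym ![s' == _]eq_sym [i == _]eq_sym [j == _]eq_sym.
  rewrite [p == _]eq_sym.
  by rewrite (andbCA (j' == i)); case: s; case: s'.
by rewrite ![s == _]eq_sym [i == _]eq_sym; case: fl; case: fl'.
Qed.

Lemma blob_adj_irr : irreflexive blob_adj.
Proof.
move=> [[[[s i] j] p]|[[[[s i] fl] w] d]] /=; first by case: s.
by rewrite !eqxx; case: fl.
Qed.

Lemma card_blob : #|blob| = 10 * (k * k) * (2 ^ q * 2 ^ q).
Proof. rewrite card_sum !card_prod !card_bool !card_ord card_word; nia. Qed.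

(** A terminal sees at least a quarter of the flagged core vertices of its blob, and a core vertex
    sees the whole opposite half, so degrees are at least k 4^q / 2 out of 10 k^2 4^q vertices. *)
Lemma blob_degree x : #|blob| <= 20 * k * #|[set y | blob_adj x y]|.
Proof.
have step m : k * (2 ^ q * 2 ^ q) <= 2 * m -> #|blob| <= 20 * k * m.
  by rewrite card_blob => h; nia.
case: x => [[[[s i] j] p]|[[[[s i] fl] w] d]]; apply: step.
  pose f (z : (word * bool) * ('I_k * word)) : blob := inr (s, i, true, z.1, z.2).
  have f_inj : injective f by move=> [w d] [w' d'] [-> ->].
  apply: (@leq_trans (2 * #|f @: setX [set w | separates w p] setT|)).
    rewrite card_imset // cardsX cardsT card_prod card_ord card_word.
    by have := card_separates p; nia.
  rewrite leq_pmul2l //; apply/subset_leq_card/subsetP => y /imsetP[[w d]].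
  by rewrite !inE /= andbT => sep ->; rewrite /= !eqxx sep.
pose f (z : (word * bool) * ('I_k * word)) : blob := inr (s, i, ~~ fl, z.1, z.2).
have f_inj : injective f by move=> [w1 d1] [w' d'] [-> ->].
apply: (@leq_trans (2 * #|f @: setT|)).
  rewrite card_imset // cardsT !card_prod card_bool card_ord card_word; nia.
rewrite leq_pmul2l //; apply/subset_leq_card/subsetP => y /imsetP[[w1 d1] _ ->].
by rewrite inE /= !eqxx.
Qed.

Section Potential.
Variables (s0 : bool) (i0 j0 : 'I_k) (p0 : word * word).

(** Terminals of one blob with labels p and p0 then have a common core neighbour, giving distance at
    most 2 instead of 4. *)
Definition meets p := [exists w, separates w p && separates w p0].

(* A lower bound for the distance to the terminal (s0, i0, j0, p0). *)
Definition potential (x : blob) : nat :=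
  match x with
  | inl (s, i, j, p) =>
      if s == s0 then
        if i == i0 then
          if (j == j0) && (p == p0) then 0 else if meets p then 2 else 4
        else if (j == j0) && meets p then 4 else 6
      else
        if j == i0 then
          if (i == j0) && (p == p0) then 1 else if meets p then 3 else 5
        else if (i == j0) && meets p then 3 else 5
  | inr (s, i, fl, w, _) =>
      if s == s0 then
        if i == i0 then if fl then if separates w p0 then 1 else 3 else 2
        else if fl then 5 else 4
      else if fl then if (i == j0) && separates w p0 then 2 else 4 else 3
  end.

Lemma potential_lipschitz x y : blob_adj x y -> potential y <= (potential x).+1.
Proof.
(* A core vertex adjacent to label p either separates p0 too, witnessing [meets p], or shows p !=
   p0. The rest is a finite case check. *)
have meetsI w p : separates w p ->
    if separates w p0 then meets p = true else (p == p0) = false.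
  move=> wp; case: ifPn => [wp0|]; first by apply/existsP; exists w; rewrite wp.
  by move=> wp0; apply: contraNF wp0 => /eqP <-.
case: x y => [[[[s i] j] p]|[[[[s i] fl] w] d]]
  [[[[s' i'] j'] p']|[[[[s' i'] fl'] w'] d']] /=.
- case/and4P=> /eqP-> /eqP-> /eqP-> /eqP->.
  have -> : (~~ s == s0) = ~~ (s == s0) by case: s; case: s0.
  by case: (s == s0); case: (i == i0); case: (j == j0); case: (p == p0);
     case: (meets p); case: (i == j0); case: (j == i0).
- case/and4P=> /eqP-> /eqP-> -> /meetsI; case: ifP => _ ->; case: (s == s0);
    case: (i == i0); case: (j == j0); case: (p == p0); case: (j == i0);
    case: (i == j0); by rewrite //=; case: ifP.
- case/and4P=> /eqP-> /eqP-> -> /meetsI; case: ifP => _ ->; case: (s' == s0);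
    case: (i' == i0); case: (j' == j0); case: (p' == p0); case: (j' == i0);
    case: (i' == j0); by rewrite //=; case: ifP.
- case/and3P=> /eqP-> /eqP-> /eqP->; case: (s == s0); case: (i == i0); case: (i == j0);
    by case: fl => //=; case: ifP.
Qed.

Lemma potential_source : potential (inl (s0, i0, j0, p0)) = 0.
Proof. by rewrite /= !eqxx. Qed.

(** When j = j0, the 6 consists of two matching edges and 4 steps through the shared opposite
    blob. *)
Lemma potential_other_blob i j p : i != i0 -> ~~ meets p ->
  potential (inl (s0, i, j, p)) = 6.
Proof. by move=> /negPf ii /negPf np; rewrite /= eqxx ii np andbF. Qed.

Lemma potential_other_side i j p : p != p0 -> ~~ meets p ->
  potential (inl (~~ s0, i, j, p)) = 5.
Proof.
move=> /negPf pp /negPf np; rewrite /= pp np !andbF.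
by case: s0 => /=; case: ifP.
Qed.

End Potential.

Lemma meets_consecutive a b c : a != b -> b != c -> ~~ meets (a, b) (b, c).
Proof.
move=> ab bc; apply/existsPn => w; apply/negP => /andP[wbc wab].
exact: separates_consecutive ab bc wab wbc.
Qed.

Section Colouring.
Variables (R : realType) (eps : R) (n d l : nat).
Hypotheses (k_gt0 : 0 < k) (eps_ge0 : (0 <= eps)%R).
Hypotheses (eps_le : (40 * k%:R * eps <= 1)%R) (n_ge : #|blob| <= n).
Hypothesis cov : covers_all n eps d l.

(** The 40 in [eps_le] is the rounding factor 2 of the blow-up times the 20 of [blob_degree]. *)
Lemma blob_colouring : exists2 g : blob -> blob -> nat,
  forall x y, blob_adj x y -> g x y < l &
  forall x y x' y' (f : blob -> nat), blob_adj x y -> blob_adj x' y' ->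
    g x y = g x' y' -> (forall u v, blob_adj u v -> f v <= (f u).+1) ->
    [/\ f x' <= f x + d, f y' <= f x + d & f y' <= f y + d].
Proof.
pose o := Ordinal k_gt0; pose z : word := [ffun=> false].
pose x0 : blob := inl (false, o, o, (z, z)).
pose deg := [arg min_(x < x0) #|[set y | blob_adj x y]|].
have blob_gt0 : 0 < #|blob| by apply/card_gt0P; exists deg.
apply: (@blow_up_colouring _ _ n blob_adj_sym blob_adj_irr blob_gt0 n_ge R eps
  #|[set y | blob_adj deg y]|) => //.
  have := blob_degree deg; rewrite -(ler_nat R) !natrM => le.
  have eps2 : (0 <= 2 * eps)%R by rewrite mulr_ge0.
  have := ler_wpM2l eps2 le.
  have := ler_wpM2r (ler0n R #|[set y | blob_adj deg y]|) eps_le.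
  lra.
by move=> x; rewrite /deg; case: arg_minnP => // y _; apply.
Qed.

Let term s i j p : blob := inl (s, i, j, p).

Lemma matched_terminals s i j p : blob_adj (term s i j p) (term (~~ s) j i p).
Proof. by rewrite /= !eqxx. Qed.

Lemma blob_cover_log : d <= 4 -> q <= l.+1.
Proof.
move=> d4; have [g gl gP] := blob_colouring; pose o := Ordinal k_gt0.
rewrite leqNgt; apply/negP => lq.
pose e p := g (term false o o p) (term true o o p).
(* Colours lie below l, but [inord] needs the inhabited type ['I_l.+1]; hence the successor in the
   bound. *)
have [|a [b [c [ab bc /(congr1 val)]]]] := @shift_pair word 'I_l.+1 (fun p => inord (e p)).
  by rewrite card_ord card_word ltn_exp2l.
have el p : e p < l.+1 by rewrite ltnS ltnW // gl // (matched_terminals false).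
rewrite /= !inordK // => ee.
have [_] := gP _ _ _ _ (potential false o o (a, b)) (matched_terminals _ _ _ _)
  (matched_terminals _ _ _ _) ee (@potential_lipschitz _ _ _ _).
rewrite potential_source potential_other_side //; last exact: meets_consecutive.
  by rewrite add0n ltnNge d4.
by rewrite xpair_eqE negb_and eq_sym ab.
Qed.

Lemma blob_cover_square : d <= 5 -> l.+1 ^ (k * k) < q -> k * k <= l.
Proof.
move=> d5 lq; have [g gl gP] := blob_colouring; pose o := Ordinal k_gt0.
pose e p (z : 'I_k * 'I_k) := g (term false z.1 z.2 p) (term true z.2 z.1 p).
have el p z : e p z < l by rewrite gl // (matched_terminals false).
(* The colour of a pair is now the vector of its k^2 edge colours, one of (l + 1)^(k^2)
   possibilities. *)
have [|a [b [c [ab bc /ffunP ee]]]] :=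
  @shift_pair word {ffun 'I_k * 'I_k -> 'I_l.+1} (fun p => [ffun z => inord (e p z)]).
  by rewrite card_ffun card_prod !card_ord card_word ltn_exp2l.
have {}ee z : e (a, b) z = e (b, c) z.
  by have /(congr1 val) := ee z; rewrite !ffunE /= !inordK // ltnW // ltnS.
have e_inj : injective (fun z => Ordinal (el (a, b) z)).
  (* By [ee] the second edge may be relabelled (b, c) without changing its colour. Its label then
     does not meet (a, b), so i != i' or j != j' puts the ends on side false or true, respectively,
     at distance at least 6. *)
  move=> [i j] [i' j'] /(congr1 val) /=; rewrite [RHS]ee /e /= => eij.
  apply/eqP; rewrite xpair_eqE; apply/andP; split; apply: contraT => ne.
    have [+ _ _] := gP _ _ _ _ (potential false i j (a, b)) (matched_terminals _ _ _ _)
      (matched_terminals _ _ _ _) eij (@potential_lipschitz _ _ _ _).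
    rewrite potential_source potential_other_blob 1?eq_sym ?meets_consecutive //.
    by rewrite add0n ltnNge d5.
  have [_ _] := gP _ _ _ _ (potential true j i (a, b)) (matched_terminals _ _ _ _)
    (matched_terminals _ _ _ _) eij (@potential_lipschitz _ _ _ _).
  rewrite potential_source potential_other_blob 1?eq_sym ?meets_consecutive //.
  by rewrite add0n ltnNge d5.
by have := leq_card _ e_inj; rewrite card_prod !card_ord.
Qed.

End Colouring.
End ShiftBlobs.

(** * Asymptotics *)

From mathcomp Require Import all_classical all_reals all_analysis.
Import Order.TTheory GRing.Theory Num.Theory.
Import numFieldNormedType.Exports.

Section Bounds.
Variables (R : realType) (n : nat) (eps : R).

Lemma Q_covers d (d0 : 0 < d) : covers_all n eps d (Q n eps d0).
Proof. by rewrite /Q; case: ex_minnP. Qed.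

Lemma Q_le d (d0 : 0 < d) l :
  (forall E : {set {set 'I_n}}, simple_graph E -> min_degree_ge E (eps * n%:R)%R ->
    coverable E l d) -> Q n eps d0 <= l.
Proof.
move=> cov; rewrite /Q; case: ex_minnP => m _; apply.
by apply/forallP => E; apply/implyP => /andP[]; apply: cov.
Qed.

Lemma Q_anti d (d0 : 0 < d) d' (d'0 : 0 < d') : d <= d' -> Q n eps d'0 <= Q n eps d0.
Proof.
move=> dd; apply: Q_le => E sE dE.
have /implyP/(_ _)/existsP[|F /andP[EF /forallP dF]] := forallP (Q_covers d0) E.
  by rewrite sE.
apply/existsP; exists F; rewrite EF; apply/forallP => i; apply/diam_leP => x y xF yF.
by have [m md hm] := diam_leP _ _ (dF i) x y xF yF; exists m; rewrite ?(leq_trans md).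
Qed.

End Bounds.

Local Open Scope classical_set_scope.
Local Open Scope ring_scope.

Section Asymptotics.
Variables (R : realType) (eps : R).
Hypothesis eps_gt0 : 0 < eps.

Lemma Q6_upper n : (Q n eps (isT : (0 < 6)%N))%:R <= eps^-1.
Proof.
apply: (@le_trans _ _ (Num.truncn eps^-1)%:R); last by rewrite truncn_le invr_ge0 ltW.
by rewrite ler_nat; apply: Q_le => E; apply: coverable6.
Qed.

Lemma Q5_upper n : (Q n eps (isT : (0 < 5)%N))%:R <= eps ^- 2.
Proof.
apply: (@le_trans _ _ (Num.truncn (eps ^- 2))%:R).
  by rewrite ler_nat; apply: Q_le => E; apply: coverable5.
by rewrite truncn_le invr_ge0 exprn_ge0 // ltW.
Qed.

Lemma Q3_upper n : eps <= 1 -> 1 <= ln (n%:R : R) ->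
  (Q n eps (isT : (0 < 3)%N))%:R <= (2 * eps ^- 2 + 1) * ln (n%:R : R).
Proof.
move=> eps1 ln1; have n0 : (0 : R) < n%:R.
  by rewrite lt_neqAle ler0n andbT; apply: contraTneq ln1 => <-; rewrite ln0 // -ltNge.
have e2 : 0 < eps ^+ 2 by rewrite exprn_gt0.
(* Chosen so that (1 - eps^2)^t n^2 <= exp(2 ln n - t eps^2) < 1; the successor is absorbed by 1 <=
   ln n. *)
pose t := (Num.truncn (2 * eps ^- 2 * ln (n%:R : R))).+1.
have y0 : 0 <= 2 * eps ^- 2 * ln (n%:R : R).
  by rewrite mulr_ge0 ?mulr_ge0 ?invr_ge0 ?(ltW e2) // (le_trans _ ln1).
apply: (@le_trans _ _ t%:R); last first.
  by rewrite mulrDl mul1r [t%:R]mulrS addrC; apply: lerD; rewrite ?truncn_le.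
rewrite ler_nat; apply: Q_le => E sE dE; apply: (coverable3 eps_gt0 sE dE eps1).
have lt_t : 2 * ln (n%:R : R) < t%:R * eps ^+ 2.
  have : 2 * eps ^- 2 * ln (n%:R : R) < t%:R by rewrite /t truncnS_gt.
  by rewrite -(ltr_pM2r e2); congr (_ < _); field; rewrite gt_eqF.
apply: (@le_lt_trans _ _ (expR (- (t%:R * eps ^+ 2) + 2 * ln (n%:R : R)))).
  rewrite expRD expRM_natl lnK //; apply: ler_wpM2r; first by rewrite exprn_ge0 // ltW.
  rewrite -[X in expR X]mulrN expRM_natl; apply: lerXn2r.
  - by rewrite nnegrE subr_ge0 expr_le1 // ltW.
  - by rewrite nnegrE expR_ge0.
  - exact: expR_ge1Dx.
by rewrite expR_lt1; lra.
Qed.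

Lemma Q_clique_lower m d (d0 : (0 < d)%N) n : (0 < m)%N -> 2 * m%:R * eps <= 1 ->
  (4 * m <= n)%N -> (m <= Q n eps d0)%N.
Proof.
move=> m0 me mn; apply: (disjoint_cliques m0 _ _ (Q_covers n eps d0)); first by lia.
have := divn_eq n m; have := ltn_pmod n m0; set t := (n %/ m)%N => lt nE.
have t4 : (4 <= t)%N by rewrite leq_divRL.
have -> : t.-1%:R = t%:R - 1 :> R by rewrite -subn1 natrB //; lia.
(* Then eps n <= (t + 1) / 2 <= t - 1, using t >= 4. *)
have n_le : (n%:R : R) <= (t%:R + 1) * m%:R.
  by rewrite natr1 -natrM ler_nat nE mulSn addnC leq_add2r ltnW.
have {}t4 : (4 : R) <= t%:R by rewrite (ler_nat _ 4).
have := ler_wpM2l (ltW eps_gt0) n_le.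
have : (t%:R + 1) * (2 * m%:R * eps) <= (t%:R + 1) * 1 :> R.
  by apply: ler_wpM2l => //; lra.
lra.
Qed.

(** The complete graph gives the lower bound 1, which settles the range where [eps] is too large for
    the other constructions. *)
Lemma Q_clique_lower1 d (d0 : (0 < d)%N) : eps < 1 ->
  \forall n \near \oo, (1 <= Q n eps d0)%N.
Proof.
move=> eps1; exists (Num.truncn (1 - eps)^-1).+2 => // n /= hn.
apply: (disjoint_cliques (m := 1) _ _ _ (Q_covers n eps d0)) => //.
  by apply: leq_trans hn.
have n0 : (0 < n)%N by apply: leq_trans hn.
rewrite divn1 -subn1 natrB //.
have e1 : 0 < 1 - eps by rewrite subr_gt0.
have : (1 - eps)^-1 <= n%:R.
  apply: (@le_trans _ _ (Num.truncn (1 - eps)^-1).+1%:R).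
    by rewrite ltW // truncnS_gt.
  by rewrite ler_nat ltnW.
by rewrite -(ler_pM2l e1) divff ?gt_eqF //; lra.
Qed.

Lemma truncn_half (x : R) : 1 <= x -> (0 < Num.truncn x)%N /\ x / 2 <= (Num.truncn x)%:R.
Proof.
move=> x1; have xt : x < (Num.truncn x).+1%:R by rewrite truncnS_gt.
have t1 : (0 < Num.truncn x)%N by rewrite truncn_gt0.
split=> //; have : (1 : R) <= (Num.truncn x)%:R by rewrite (ler_nat _ 1).
by rewrite -natr1 in xt; lra.
Qed.


Lemma Q6_lower : eps < 1 ->
  \forall n \near \oo, 4^-1 * eps^-1 <= (Q n eps (isT : (0 < 6)%N))%:R.
Proof.
move=> eps1; have [eps2|eps2] := ltrP (2^-1) eps.
  near=> n; apply: (@le_trans _ _ 1%:R); last first.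
    by rewrite ler_nat; near: n; apply: Q_clique_lower1.
  have : eps^-1 < 2 by rewrite invf_plt ?posrE.
  lra.
have [|m0 mx] := @truncn_half (2^-1 * eps^-1).
  by rewrite -invfM invf_ge1 ?mulr_gt0 // mulrC -ler_pdivlMr // mul1r.
set m := Num.truncn _ in m0 mx.
exists (4 * m)%N => // n /= mn.
apply: (@le_trans _ _ m%:R); first by lra.
rewrite ler_nat; apply: Q_clique_lower => //.
have : m%:R <= 2^-1 * eps^-1 by rewrite truncn_le mulr_ge0 ?invr_ge0 // ltW.
by rewrite -invfM -[_^-1]mul1r ler_pdivlMr ?mulr_gt0 // mulrA [m%:R * 2]mulrC.
Unshelve. all: by end_near.
Qed.

Lemma Q5_lower : eps < 1 ->
  \forall n \near \oo, 80^-1 ^+ 2 * eps ^- 2 <= (Q n eps (isT : (0 < 5)%N))%:R.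
Proof.
move=> eps1; have [eps2|eps2] := ltrP (40^-1) eps.
  near=> n; apply: (@le_trans _ _ 1%:R); last first.
    by rewrite ler_nat; near: n; apply: Q_clique_lower1.
  have e40 : eps^-1 < 40 by rewrite invf_plt ?posrE.
  have e0 : 0 < eps^-1 by rewrite invr_gt0.
  by rewrite -exprVn; nra.
have [|k0 kx] := @truncn_half (40^-1 * eps^-1).
  by rewrite -invfM invf_ge1 ?mulr_gt0 // mulrC -ler_pdivlMr // mul1r.
set k := Num.truncn _ in k0 kx.
have ke : 40 * k%:R * eps <= 1.
  have : k%:R <= 40^-1 * eps^-1 by rewrite truncn_le mulr_ge0 ?invr_ge0 // ltW.
  by rewrite -invfM -[_^-1]mul1r ler_pdivlMr ?mulr_gt0 // mulrA [k%:R * 40]mulrC.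
(* If l < k^2, then (l + 1)^(k^2) <= (k^2)^(k^2) < q, as [blob_cover_square] requires; q depends on
   [eps] only. *)
pose q := ((k * k) ^ (k * k)).+1%N.
exists #|blob k q| => // n /= nk.
apply: (@le_trans _ _ (k * k)%:R).
  have e0 : 0 < eps^-1 by rewrite invr_gt0.
  by rewrite natrM -exprVn; nra.
rewrite ler_nat leqNgt; apply/negP => lt.
have cov := Q_covers n eps (isT : (0 < 5)%N).
suff : (k * k <= Q n eps (isT : (0 < 5)%N))%N by rewrite leqNgt lt.
apply: (blob_cover_square k0 (ltW eps_gt0) ke nk cov (leqnn 5)).
by rewrite ltnS leq_exp2r // muln_gt0 k0.
Unshelve. all: by end_near.
Qed.

Lemma Q4_lower n : eps <= 40^-1 -> (512 <= n)%N ->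
  16^-1 * ln (n%:R : R) <= (Q n eps (isT : (0 < 4)%N))%:R.
Proof.
(* With k = 1 there are 10 * 4^q <= 2^(4 + 2q) blob vertices, and q is the largest value keeping
   this power at most 2^r <= n. *)
move=> eps40 n512; pose r := trunc_log 2 n; pose q := (r - 4)./2.
have n0 : (0 < n)%N by apply: leq_trans n512.
have r9 : (9 <= r)%N by apply: trunc_log_max.
have qr : (r <= 2 * q + 5)%N by rewrite /q; lia.
have q_le : (q <= (Q n eps (isT : (0 < 4)%N)).+1)%N.
  apply: (@blob_cover_log 1 q R eps n 4 _ isT (ltW eps_gt0) _ _
    (Q_covers _ _ _) (leqnn 4)).
    by rewrite mulr1 mulrC -ler_pdivlMr // mul1r.
  rewrite card_blob -expnD; apply: leq_trans (trunc_logP (isT : (1 < 2)%N) n0).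
  apply: (@leq_trans (2 ^ (4 + (q + q)))); first by rewrite [leqRHS]expnD leq_mul2r orbT.
  by rewrite leq_exp2l // -/r /q; lia.
have ln_le : ln (n%:R : R) <= r.+1%:R.
  apply: (@le_trans _ _ (ln (2 ^+ r.+1))).
    rewrite ler_ln ?posrE ?ltr0n ?exprn_gt0 //.
    by rewrite -natrX ler_nat ltnW // trunc_log_ltn.
  rewrite lnXn // -[leLHS]mulr_natl -[leRHS]mulr1 ler_wpM2l //.
  by rewrite -[2]/(1 + 1) le_ln1Dx // (lt_trans _ ltr01) // ltrN10.
(* From r >= 9 follow q >= 2 and a positive [Q], which absorbs the additive constants. *)
have : (r.+1 <= 16 * Q n eps (isT : (0 < 4)%N))%N by lia.
rewrite -(ler_nat R) natrM; lra.
Qed.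

End Asymptotics.

Lemma Theta_log (R : realType) (f : nat -> nat) (c C : R) (N : nat) :
  0 < c -> 0 < C ->
  (forall n, (N <= n)%N -> 1 <= ln (n%:R : R) ->
     c * ln (n%:R : R) <= (f n)%:R <= C * ln (n%:R : R)) ->
  (fun n : nat => (f n)%:R : R^o) =Theta_\oo (fun n : nat => ln (n%:R : R) : R^o).
Proof.
move=> c0 C0 bnd; rewrite eqThetaE qualifE; apply/asboolP.
exists (c, C) => /=; first by rewrite c0.
exists (maxn N (Num.truncn (expR 1 : R)).+1) => // n /=; rewrite geq_max => /andP[Nn en].
have ln1 : 1 <= ln (n%:R : R).
  have e_le : expR 1 <= n%:R :> R.
    by apply: le_trans (ltW (truncnS_gt _)) _; rewrite ler_nat.
  by rewrite -[1 in leLHS]expRK ler_ln ?posrE ?expR_gt0 // (lt_le_trans _ e_le) ?expR_gt0.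
have /andP[lo hi] := bnd n Nn ln1.
by rewrite !ger0_norm // (le_trans ler01).
Qed.

(** In (b) the constants are fixed before [eps]. For [eps >= 1] and n > 0 no simple graph has the
    required minimum degree and [Q] is 0, whence the range [eps < 1]. *)
Theorem theorem1p4 (R : realType) :
  (forall eps : R, 0 < eps -> eps <= 2 ^- 8 ->
     ((fun n : nat => (Q n eps (isT : (0 < 3)%N))%:R : R^o)
        =Theta_\oo (fun n : nat => ln (n%:R : R) : R^o)) /\
     ((fun n : nat => (Q n eps (isT : (0 < 4)%N))%:R : R^o)
        =Theta_\oo (fun n : nat => ln (n%:R : R) : R^o)))
  /\
  ((exists c C : R, [/\ 0 < c, 0 < C & forall eps : R, 0 < eps -> eps < 1 ->
      (forall n : nat, (Q n eps (isT : (0 < 5)%N))%:R <= C * eps ^- 2) /\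
      (\forall n \near \oo, c * eps ^- 2 <= (Q n eps (isT : (0 < 5)%N))%:R)]) /\
   (exists c C : R, [/\ 0 < c, 0 < C & forall eps : R, 0 < eps -> eps < 1 ->
      (forall n : nat, (Q n eps (isT : (0 < 6)%N))%:R <= C * eps ^-1) /\
      (\forall n \near \oo, c * eps ^-1 <= (Q n eps (isT : (0 < 6)%N))%:R)])).
Proof.
split=> [eps eps0 eps_le|].
  have eps40 : eps <= 40^-1 by apply: le_trans eps_le _; rewrite lef_pV2 ?posrE //; lra.
  have C0 : 0 < 2 * eps ^- 2 + 1 by rewrite addr_gt0 // mulr_gt0 // invr_gt0 exprn_gt0.
  have eps1 : eps <= 1 by lra.
  have c0 : (0 : R) < 16^-1 by [].
  (* Monotonicity in d leaves only the lower bound for d = 4 and the upper bound for d = 3. *)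
  have Q34 n : (Q n eps (isT : (0 < 4)%N))%:R <= (Q n eps (isT : (0 < 3)%N))%:R :> R.
    by rewrite ler_nat Q_anti.
  split; apply: (@Theta_log _ _ (16^-1) (2 * eps ^- 2 + 1) 512) => // n n512 ln1;
    apply/andP; split.
  - exact: le_trans (Q4_lower eps0 eps40 n512) (Q34 n).
  - exact: Q3_upper.
  - exact: Q4_lower.
  - exact: le_trans (Q34 n) (Q3_upper eps0 eps1 ln1).
split.
  exists (80^-1 ^+ 2), 1; split; rewrite ?exprn_gt0 ?invr_gt0 // => eps eps0 eps1.
  split=> [n|]; last exact: Q5_lower.
  by rewrite mul1r; apply: Q5_upper.
exists (4^-1), 1; split=> // eps eps0 eps1; split=> [n|]; last exact: Q6_lower.
by rewrite mul1r; apply: Q6_upper.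
Qed.
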